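(* Let the system matrix $B$, the bounds $\bar x,\bar u$, the weights $s,r$ and the gain matrix $K$ be as in the context. Write $\Lambda=\operatorname{diag}(\lambda)$ and let $$L=\{\lambda\in(0,1]^n : K\Lambda\bar x\le\bar u\ \text{ and }\ BK\Lambda\bar x\le0\},\qquad \hat p(\lambda)=-(BK)^{-\top}(\Lambda^{-1}s+K^\top r),$$ and $$\gamma^\star=\min\{\max\{\hat p_i(\lambda)/s_i : i\in\mathcal{V}\} : \lambda\in L\}.$$ Then the optimization problem $$\begin{aligned}\text{minimize over }(\gamma,\lambda)\quad &\gamma\\ \text{subject to}\quad &\lambda\in L,\\ &\gamma s\ge-(BK)^{-\top}(\Lambda^{-1}s+K^\top r)\end{aligned}$$ is a geometric program in the variables $(\gamma,\lambda)$, and its optimal value is $\gamma^\star$.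
   Context: Notation: inequalities between vectors are element-wise, $e_i$ is the $i$-th canonical basis vector of $\mathbb{R}^n$, and $M^{-\top}=(M^{-1})^\top$. (The matrix $BK$ below is invertible.) System. Consider a directed graph with vertices $\mathcal{V}=\{1,\dots,n\}$ and an additional goal vertex $g=n+1$. Vertex $i\in\mathcal{V}$ has $m_i$ outgoing edges, each leading to a successor vertex $j\in(\mathcal{V}\cup\{g\})\setminus\{i\}$; $m=\sum_i m_i$. The matrix $B=(B_1\ \cdots\ B_n)\in\mathbb{R}^{n\times m}$ has blocks $B_i\in\mathbb{R}^{n\times m_i}$ with one column per outgoing edge of $i$ (ordered by the label of the successor): the column for edge $(i,j)$ with $j\in\mathcal{V}$ has entry $-1$ in row $i$, entry $1$ in row $j$, and zeros elsewhere; the column for edge $(i,g)$ has entry $-1$ in row $i$ and zeros elsewhere. Vectors in $\mathbb{R}^m$ are partitioned as $u=(u_1,\dots,u_n)$ with $u_i\in\mathbb{R}^{m_i}$. Data. $\bar x\in\mathbb{R}^n_{>0}$ and $\bar u\in\mathbb{R}^m_{>0}$ are given capacity bounds; $s\in\mathbb{R}^n_{>0}$ and $r=(r_1,\dots,r_n)\in\mathbb{R}^m_{\ge0}$ are given cost weights. Gain matrix $K$. Standing assumption: there exists $p\in\mathbb{R}^n_{>0}$ with $s+\sum_{i=1}^n\min\{r_i+B_i^\top p,0\}e_i=0$, where $\min\{r_i+B_i^\top p,0\}$ denotes the smallest number among the entries of the vector $r_i+B_i^\top p\in\mathbb{R}^{m_i}$ and $0$; fix such a $p$. For each $i\in\mathcal{V}$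 let $k$ be the first index of a minimal entry of $r_i+B_i^\top p$, and let $K_i\in\mathbb{R}^{m_i\times n}$ be the matrix whose $k$-th row is $e_i^\top$ and whose other rows are zero. Then $K=\begin{pmatrix}K_1^\top&\cdots&K_n^\top\end{pmatrix}^\top\in\mathbb{R}^{m\times n}$. Geometric program. A monomial in positive variables $y_1,\dots,y_q$ is a function $c\,y_1^{a_1}\cdots y_q^{a_q}$ with $c>0$ and $a_i\in\mathbb{R}$; a posynomial is a finite sum of monomials. A geometric program is a problem of minimizing a posynomial over strictly positive variables subject to finitely many constraints of the form $f(y)\le1$ with $f$ a posynomial. A problem over strictly positive variables is called a geometric program here if each of its scalar constraints can be equivalently rewritten in this form (scalar constraints whose left-hand side is identically zero, i.e. an empty sum of monomials, are trivially satisfied and may be dropped). *)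

(* Defs.v *)
From HB Require Import structures.
From mathcomp Require Import all_boot all_order all_algebra.
From mathcomp Require Import mathcomp_extra boolp classical_sets reals.
From mathcomp Require Import constructive_ereal ereal exp.

Set Implicit Arguments.
Unset Strict Implicit.
Unset Printing Implicit Defensive.

Import Order.TTheory GRing.Theory Num.Theory.

Local Open Scope classical_set_scope.
Local Open Scope ring_scope.

Definition lev (R : realType) n (u v : 'cV[R]_n) : Prop :=
  forall i, u i 0 <= v i 0.

Definition ltv (R : realType) n (u v : 'cV[R]_n) : Prop :=
  forall i, u i 0 < v i 0.

Definition is_minimum (R : realType) (A : set R) (a : R) : Prop :=
  A a /\ lbound A a.

(* The index type ['I_n] must be inhabited, so that the neutral element of the
   iterated maximum can be taken among the entries. *)
Definition max_entry (R : realType) n (n_gt0 : (0 < n)%N) (f : 'I_n -> R) : R :=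
  \big[Num.max/f (Ordinal n_gt0)]_(i < n) f i.

(** * Geometric programs *)

Record monomial (R : realType) (q : nat) := Monomial {
  mon_coef : R;
  mon_exp : 'I_q -> R;
  mon_coef_gt0 : 0 < mon_coef }.

Definition mon_eval (R : realType) q (t : monomial R q) (y : 'cV[R]_q) : R :=
  mon_coef t * \prod_(i < q) (y i 0 `^ mon_exp t i).

Definition sum_monomials (R : realType) q (f : seq (monomial R q))
    (y : 'cV[R]_q) : R :=
  \sum_(t <- f) mon_eval t y.

Definition is_posynomial (R : realType) q (h : 'cV[R]_q -> R) : Prop :=
  exists f : seq (monomial R q),
    (0 < size f)%N /\ forall y, ltv 0 y -> h y = sum_monomials f y.

(* Minimize [objective y] over the strictly positive [y] such that
   [clhs y k <= crhs y k] for each of the [c] scalar constraints [k]. *)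
Record program (R : realType) (q c : nat) := Program {
  objective : 'cV[R]_q -> R;
  clhs : 'cV[R]_q -> 'cV[R]_c;
  crhs : 'cV[R]_q -> 'cV[R]_c }.

Definition feasible (R : realType) q c (P : program R q c) : set 'cV[R]_q :=
  [set y | ltv 0 y /\ lev (clhs P y) (crhs P y)].

Definition optimal_value (R : realType) q (h : 'cV[R]_q -> R)
    (F : set 'cV[R]_q) : \bar R :=
  ereal_inf [set (h y)%:E | y in F].

(* Equivalent over the positive orthant to [f <= 1], with [f] a posynomial; the
   empty [f] accounts for a trivially satisfied constraint, which is dropped. *)
Definition gp_constraint (R : realType) q (C : set 'cV[R]_q) : Prop :=
  exists f : seq (monomial R q),
    forall y, ltv 0 y -> (C y <-> sum_monomials f y <= 1).

Definition is_geometric_program (R : realType) q c (P : program R q c) : Prop :=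
  is_posynomial (objective P) /\
  forall k : 'I_c, gp_constraint [set y | clhs P y k 0 <= crhs P y k 0].

(** * Network system *)

(* The vertices [1, ..., n] are the elements of ['I_n]; among all vertices
   ['I_n.+1] the goal is [ord_max].  [E i] is the set of successors of [i], so
   that [m_i] is [#|E i|] and [enum_val j] is the [j]-th successor of [i] in
   increasing order. *)
Definition no_loop n (E : 'I_n -> {set 'I_n.+1}) : Prop :=
  forall i : 'I_n, widen_ord (leqnSn n) i \notin E i.

Definition edges n (E : 'I_n -> {set 'I_n.+1}) : nat :=
  (\sum_(i < n) #|E i|)%N.

Definition Bblock (R : realType) n (E : 'I_n -> {set 'I_n.+1}) (i : 'I_n) :
    'M[R]_(n, #|E i|) :=
  \matrix_(k, j) (if k == i then -1
                  else if ((enum_val j : 'I_n.+1) == k :> nat) then 1 else 0).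

Definition Bmat (R : realType) n (E : 'I_n -> {set 'I_n.+1}) :
    'M[R]_(n, edges E) :=
  \mxrow_(i < n) Bblock R E i.

Definition reduced_cost (R : realType) n (E : 'I_n -> {set 'I_n.+1})
    (r : 'cV[R]_(edges E)) (p : 'cV[R]_n) (i : 'I_n) : 'cV[R]_(#|E i|) :=
  submxcol r i + (Bblock R E i)^T *m p.

Definition bellman_equation (R : realType) n (E : 'I_n -> {set 'I_n.+1})
    (s : 'cV[R]_n) (r : 'cV[R]_(edges E)) (p : 'cV[R]_n) : Prop :=
  s + \sum_(i < n)
        (\big[Num.min/0]_(j < #|E i|) reduced_cost r p i j 0) *: delta_mx i 0
  = 0.

Definition first_argmin (R : realType) k (v : 'cV[R]_k) (j : 'I_k) : bool :=
  [forall l : 'I_k, (v j 0 <= v l 0) && ((l < j)%N ==> (v j 0 < v l 0))].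

Definition Kblock (R : realType) n (E : 'I_n -> {set 'I_n.+1})
    (r : 'cV[R]_(edges E)) (p : 'cV[R]_n) (i : 'I_n) : 'M[R]_(#|E i|, n) :=
  \matrix_(j, l) (first_argmin (reduced_cost r p i) j && (l == i))%:R.

Definition Kmat (R : realType) n (E : 'I_n -> {set 'I_n.+1})
    (r : 'cV[R]_(edges E)) (p : 'cV[R]_n) : 'M[R]_(edges E, n) :=
  \mxcol_(i < n) Kblock r p i.

(* [w] extended by [0] at the goal. *)
Definition at_vertex (R : realType) n (w : 'I_n -> R) (t : 'I_n.+1) : R :=
  if unlift ord_max t is Some k then w k else 0.

Lemma Bblock_sum (R : realType) n (E : 'I_n -> {set 'I_n.+1}) (i : 'I_n)
    (j : 'I_#|E i|) (w : 'I_n -> R) : no_loop E ->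
  \sum_k Bblock R E i k j * w k = at_vertex w (enum_val j) - w i.
Proof.
move=> noloop; rewrite (bigD1 i) //= mxE eqxx mulN1r addrC; congr (_ - _).
have tE := enum_valP j; rewrite /at_vertex.
case: unliftP => [k tk|tg].
  have ki : k != i.
    apply: contraTneq tE => ki; rewrite tk ki.
    suff -> : lift ord_max i = widen_ord (leqnSn n) i by exact: noloop.
    by apply/val_inj; exact: lift_max.
  rewrite (bigD1 k) //= mxE (negPf ki) tk lift_max eqxx mul1r big1 ?addr0 //.
  move=> l /andP[li lk]; rewrite mxE (negPf li) tk lift_max.
  by case: eqP => [/val_inj kl|_]; rewrite ?mul0r // kl eqxx in lk *.
rewrite big1 // => l li; rewrite mxE (negPf li) tg /=.
by rewrite gtn_eqF ?mul0r.
Qed.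

Lemma bellman_step (R : realType) n (E : 'I_n -> {set 'I_n.+1})
    (s : 'cV[R]_n) (r : 'cV[R]_(edges E)) (p : 'cV[R]_n) (i : 'I_n) :
  no_loop E -> ltv 0 s -> lev 0 r -> bellman_equation s r p ->
  exists2 j : 'I_#|E i|,
    forall k, first_argmin (reduced_cost r p i) k = (k == j)
  & at_vertex (p ^~ 0) (enum_val j) < p i 0.
Proof.
move=> noloop s_gt0 r_ge0 /colP/(_ i).
set c := reduced_cost r p.
rewrite !mxE summxE (bigD1 i) //= !mxE !eqxx mulr1 big1 ?addr0; last first.
  by move=> k ki; rewrite !mxE eq_sym (negPf ki) mulr0.
move/eqP; rewrite addrC addr_eq0 => /eqP cmin.
have si : 0 < s i 0 by have := s_gt0 i; rewrite mxE.
have [j0 cj0] : exists j, c i j 0 < 0.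
  apply/existsP; apply: contraTT si => /existsPn c_ge0.
  rewrite -oppr_lt0 -cmin -leNgt; elim/big_ind: _ => //.
    by move=> x y x0 y0; rewrite le_min x0 y0.
  by move=> j _; rewrite leNgt.
case: (arg_minP (fun j => c i j 0) (isT : xpredT j0)) => j1 _ j1min.
pose Q (k : nat) :=
  [exists j : 'I_#|E i|, (j == k :> nat) && (c i j 0 == c i j1 0)].
have exQ : exists k, Q k by exists j1; apply/existsP; exists j1; rewrite !eqxx.
case: (ex_minnP exQ) => k /existsP[j /andP[/eqP jk /eqP cj]] kmin.
have jfirst : first_argmin (c i) j.
  apply/forallP => l; rewrite cj j1min //=; apply/implyP => lj.
  rewrite lt_neqAle j1min // andbT; apply/negP => /eqP cl.
  have /kmin : Q l by apply/existsP; exists l; rewrite cl !eqxx.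
  by rewrite -jk leqNgt lj.
exists j => [l|].
  apply/idP/eqP => [lfirst|->//]; apply/val_inj/eqP.
  move/forallP: jfirst => jfirst; move/forallP: lfirst => lfirst.
  case: ltngtP => // [lj|jl].
    have /andP[_ /implyP/(_ lj)] := jfirst l; have /andP[+ _] := lfirst j.
    by move=> /le_lt_trans /[apply]; rewrite ltxx.
  have /andP[_ /implyP/(_ jl)] := lfirst j; have /andP[+ _] := jfirst l.
  by move=> /le_lt_trans /[apply]; rewrite ltxx.
have : c i j 0 < 0 by rewrite cj (le_lt_trans _ cj0) ?j1min.
have -> : c i j 0 = r (tagnat.Rank i j) 0
                    + (at_vertex (p ^~ 0) (enum_val j) - p i 0).
  rewrite -Bblock_sum // !mxE; congr (_ + _).
  by apply: eq_bigr => k0 _; rewrite mxE.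
move=> lt0; rewrite -subr_lt0 (le_lt_trans _ lt0) // lerDr.
by have := r_ge0 (tagnat.Rank i j); rewrite mxE.
Qed.

Lemma BK_unitmx (R : realType) n (E : 'I_n -> {set 'I_n.+1})
    (s : 'cV[R]_n) (r : 'cV[R]_(edges E)) (p : 'cV[R]_n) :
  no_loop E -> ltv 0 s -> lev 0 r -> bellman_equation s r p ->
  Bmat R E *m Kmat r p \in unitmx.
Proof.
move=> noloop s_gt0 r_ge0 bell.
have step i := bellman_step i noloop s_gt0 r_ge0 bell.
rewrite -row_free_unit -kermx_eq0; apply/rowV0P => v /sub_kermxP vBK.
have vB i (j : 'I_#|E i|) :
    (forall k, first_argmin (reduced_cost r p i) k = (k == j)) ->
    at_vertex (v 0) (enum_val j) = v 0 i.
  move=> jfirst; apply/eqP; rewrite -subr_eq0 -Bblock_sum //; apply/eqP.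
  move/rowP: vBK => /(_ i); rewrite mxE [RHS]mxE => vBKi; rewrite -[RHS]vBKi.
  rewrite mul_mxrow_mxcol; apply: eq_bigr => k _.
  rewrite mulrC summxE (bigD1 i) //= big1 ?addr0; last first.
    move=> l li; rewrite mxE big1 // => m _.
    by rewrite [X in _ * X]mxE eq_sym (negPf li) andbF mulr0.
  congr (_ * _); rewrite [RHS]mxE (bigD1 j) //= big1 ?addr0; last first.
    by move=> m mj; rewrite [X in _ * X]mxE jfirst (negPf mj) mulr0.
  by rewrite [X in _ * X]mxE jfirst !eqxx mulr1.
apply/rowP => i; rewrite [RHS]mxE; apply/eqP/negPn/negP => vi.
case: (@arg_minP _ R _ i (fun k => v 0 k != 0) (p ^~ 0) vi) => k vk kmin.
have [j jfirst] := step k; have := vB _ _ jfirst.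
rewrite /at_vertex; case: unlift => [l vl|v0].
  by rewrite ltNge kmin // vl.
by rewrite -v0 eqxx in vk.
Qed.

(** * The optimization problem *)

Definition Lambda (R : realType) n (lam : 'cV[R]_n) : 'M[R]_n :=
  diag_mx lam^T.

Definition Lset (R : realType) n m (B : 'M[R]_(n, m)) (K : 'M[R]_(m, n))
    (xbar : 'cV[R]_n) (ubar : 'cV[R]_m) : set 'cV[R]_n :=
  [set lam | [/\ ltv 0 lam, lev lam (const_mx 1),
                 lev (K *m Lambda lam *m xbar) ubar
               & lev (B *m K *m Lambda lam *m xbar) 0]].

Definition phat (R : realType) n m (B : 'M[R]_(n, m)) (K : 'M[R]_(m, n))
    (s : 'cV[R]_n) (r : 'cV[R]_m) (lam : 'cV[R]_n) : 'cV[R]_n :=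
  - ((invmx (B *m K))^T *m (invmx (Lambda lam) *m s + K^T *m r)).

(* The variables [(gamma, lambda)] are stacked into a vector [y] of size
   [1 + n]. *)
Definition gamma_of (R : realType) n (y : 'cV[R]_(1 + n)) : R := usubmx y 0 0.

Definition lambda_of (R : realType) n (y : 'cV[R]_(1 + n)) : 'cV[R]_n :=
  dsubmx y.

(* Here [gamma] ranges over all reals. *)
Definition original_feasible (R : realType) n m (B : 'M[R]_(n, m))
    (K : 'M[R]_(m, n)) (xbar : 'cV[R]_n) (ubar : 'cV[R]_m)
    (s : 'cV[R]_n) (r : 'cV[R]_m) : set 'cV[R]_(1 + n) :=
  [set y | Lset B K xbar ubar (lambda_of y) /\
           lev (phat B K s r (lambda_of y)) (gamma_of y *: s)].

(* The same problem as a list of scalar constraints over positive variables. *)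
Definition weight_program (R : realType) n m (B : 'M[R]_(n, m))
    (K : 'M[R]_(m, n)) (xbar : 'cV[R]_n) (ubar : 'cV[R]_m)
    (s : 'cV[R]_n) (r : 'cV[R]_m) :
    program R (1 + n) (n + (m + (n + n))) :=
  {| objective := @gamma_of R n;
     clhs y := col_mx (lambda_of y)
              (col_mx (K *m Lambda (lambda_of y) *m xbar)
              (col_mx (B *m K *m Lambda (lambda_of y) *m xbar)
                      (phat B K s r (lambda_of y))));
     crhs y := col_mx (const_mx 1)
              (col_mx ubar
              (col_mx 0
                      (gamma_of y *: s))) |}.

(* Main.v *)
Require Import Defs.
From mathcomp Require Import all_boot all_order all_algebra.
From mathcomp Require Import classical_sets reals constructive_ereal ereal.
From mathcomp Require Import exp.
From mathcomp Require Import topology normedtype derive.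
Import numFieldNormedType.Exports.

Set Implicit Arguments.
Unset Strict Implicit.
Unset Printing Implicit Defensive.

Import Order.TTheory GRing.Theory Num.Theory.

Local Open Scope classical_set_scope.
Local Open Scope ring_scope.

(** Everything rests on one property of the closed-loop matrix [M = BK]: its
    off-diagonal entries are nonnegative, and it has an inverse all of whose
    entries are nonpositive (so [-M] is a nonsingular M-matrix).  Under the
    policy encoded by [K] each vertex sends its content to a single successor,
    so for a row vector [w] the [i]-th entry of [w M] is [w (succ i) - w i],
    with [w = 0] at the goal; and [p] strictly decreases along successors.
    Hence [w M <= 0] forces [w >= 0]: at a vertex with [w < 0] and least [p],
    the successor would have a negative [w] too and a smaller [p].  Applied to
    minus the rows of [M^-1] this gives the sign of the inverse
    ([closed_loop_stable_metzler]).

    The rest holds for all [B], [K >= 0] with such an [M].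
    - The program is geometric ([weight_program_is_gp]): once the single
      negative term of row [i] of [M Lambda xbar <= 0], the diagonal one, is
      moved to the right, every constraint reads posynomial <= monomial.  In
      the last constraint the posynomial is an entry of [phat], whose
      coefficients are those of [-M^-T >= 0].
    - [gamma > 0] is implied by [gamma s >= phat], since [phat > 0]; so
      restricting to positive variables loses no feasible point.
    - The minimum exists ([max_cost_attained]).  The set [L] is nonempty: scale
      the positive solution of [M z = -1].  It is bounded but not closed, as
      [lambda] may approach the boundary of the positive orthant; there however
      [phat_i >= - (M^-1)_ii s_i / lambda_i] blows up ([phat_ge]).  A sublevel
      set of the cost in [L] thus lies in a compact box away from [0], where
      the cost is continuous.
    - For fixed [lambda] the least admissible [gamma] is the largest
      [phat_i / s_i], so the two optimal values agree. *)

(** * Posynomials *)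

(** The empty sum is included so that the entries of a nonnegative matrix can be
    used as coefficients without a case distinction. *)
Definition posynomial_or_zero (R : realType) q (h : 'cV[R]_q -> R) : Prop :=
  exists f : seq (monomial R q), forall y, ltv 0 y -> h y = sum_monomials f y.

Lemma posynomial_const (R : realType) q (c : R) :
  0 <= c -> @posynomial_or_zero R q (fun=> c).
Proof.
rewrite le_eqVlt => /orP[/eqP<-|c_gt0].
  by exists [::] => y _; rewrite /sum_monomials big_nil.
exists [:: Monomial (fun=> 0) c_gt0] => y _.
rewrite /sum_monomials big_seq1 /mon_eval /= big1 ?mulr1 // => i _.
by rewrite powRr0.
Qed.

Lemma monomial_var (R : realType) q (i : 'I_q) (a : R) (y : 'cV[R]_q) :
  mon_eval (Monomial (fun k => if k == i then a else 0) ltr01) y = y i 0 `^ a.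
Proof.
rewrite /mon_eval /= mul1r (bigD1 i) //= eqxx big1 ?mulr1 // => k ki.
by rewrite (negPf ki) powRr0.
Qed.

Lemma posynomial_powR (R : realType) q (i : 'I_q) (a : R) :
  posynomial_or_zero (fun y : 'cV[R]_q => y i 0 `^ a).
Proof.
exists [:: Monomial (fun k => if k == i then a else 0) ltr01] => y _.
by rewrite /sum_monomials big_seq1 monomial_var.
Qed.

Lemma posynomial_var (R : realType) q (i : 'I_q) :
  posynomial_or_zero (fun y : 'cV[R]_q => y i 0).
Proof.
have [f fE] := posynomial_powR i (1 : R); exists f => y y_gt0.
by rewrite -fE // powRr1 // ltW //; have := y_gt0 i; rewrite mxE.
Qed.

Lemma posynomial_inv_var (R : realType) q (i : 'I_q) :
  posynomial_or_zero (fun y : 'cV[R]_q => (y i 0)^-1).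
Proof.
have [f fE] := posynomial_powR i (-1 : R); exists f => y y_gt0.
by rewrite -fE // powR_inv1 // ltW //; have := y_gt0 i; rewrite mxE.
Qed.

Lemma posynomialD (R : realType) q (g h : 'cV[R]_q -> R) :
  posynomial_or_zero g -> posynomial_or_zero h ->
  posynomial_or_zero (fun y => g y + h y).
Proof.
move=> [f1 f1E] [f2 f2E]; exists (f1 ++ f2) => y y_gt0.
by rewrite /sum_monomials big_cat /= f1E // f2E.
Qed.

Lemma posynomial_sum (R : realType) q (I : Type) (e : seq I) (P : pred I)
    (h : I -> 'cV[R]_q -> R) :
  (forall i, P i -> posynomial_or_zero (h i)) ->
  posynomial_or_zero (fun y => \sum_(i <- e | P i) h i y).
Proof.
move=> h_pos; elim: e => [|i e [f fE]].
  by exists [::] => y _; rewrite big_nil /sum_monomials big_nil.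
have [Pi|nPi] := boolP (P i).
  have [f2 f2E] := posynomialD (h_pos i Pi) (ex_intro _ f fE).
  by exists f2 => y y_gt0; rewrite big_cons Pi f2E.
by exists f => y y_gt0; rewrite big_cons (negPf nPi) fE.
Qed.

Definition mon_mul (R : realType) q (t u : monomial R q) : monomial R q :=
  Monomial (fun i => mon_exp t i + mon_exp u i)
           (mulr_gt0 (mon_coef_gt0 t) (mon_coef_gt0 u)).

Lemma mon_mulE (R : realType) q (t u : monomial R q) (y : 'cV[R]_q) :
  ltv 0 y -> mon_eval (mon_mul t u) y = mon_eval t y * mon_eval u y.
Proof.
move=> y_gt0; rewrite /mon_eval /= mulrACA -big_split /=; congr (_ * _).
apply: eq_bigr => i _; rewrite powRD //; apply/implyP => _.
by rewrite gt_eqF //; have := y_gt0 i; rewrite mxE.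
Qed.

Lemma posynomialM (R : realType) q (g h : 'cV[R]_q -> R) :
  posynomial_or_zero g -> posynomial_or_zero h ->
  posynomial_or_zero (fun y => g y * h y).
Proof.
move=> [f1 f1E] [f2 f2E]; exists [seq mon_mul t u | t <- f1, u <- f2] => y y_gt0.
rewrite f1E // f2E // /sum_monomials big_allpairs_dep mulr_suml.
apply: eq_bigr => t _; rewrite mulr_sumr; apply: eq_bigr => u _.
by rewrite mon_mulE.
Qed.

(** The constraint is rewritten as [h / g <= 1].  The hypothesis on [g^-1] is
    what sets monomials [g] apart from other posynomials. *)
Lemma gp_constraint_le (R : realType) q (C : set 'cV[R]_q)
    (g h : 'cV[R]_q -> R) :
  posynomial_or_zero h -> posynomial_or_zero (fun y => (g y)^-1) ->
  (forall y, ltv 0 y -> 0 < g y) ->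
  (forall y, ltv 0 y -> C y <-> h y <= g y) -> gp_constraint C.
Proof.
move=> h_pos g_pos g_gt0 CE; have [f fE] := posynomialM h_pos g_pos.
exists f => y y_gt0; rewrite -fE //= ler_pdivrMr ?mul1r; last exact: g_gt0.
exact: CE.
Qed.

(** * Stable Metzler matrices *)

(** For a Metzler matrix the last two conditions are equivalent to being Hurwitz;
    this form is the one in which the property is both proved and used. *)
Definition stable_metzler (R : realType) n (M : 'M[R]_n) : Prop :=
  [/\ forall i j, i != j -> 0 <= M i j, M \in unitmx
    & forall i j, invmx M i j <= 0].

(** In the diagonal entry of [M^-1 M = 1] all the terms but the diagonal product
    are nonpositive, so that product is at least [1]. *)
Lemma stable_metzler_diag (R : realType) n (M : 'M[R]_n) i :
  stable_metzler M -> M i i < 0 /\ invmx M i i < 0.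
Proof.
case=> Moff Munit Minv.
have : (invmx M *m M) i i = 1 by rewrite mulVmx // mxE eqxx.
rewrite mxE (bigD1 i) //= => ME.
have off_le0 : \sum_(k | k != i) invmx M i k * M k i <= 0.
  by apply: sumr_le0 => k ki; rewrite mulr_le0_ge0 // Moff.
have MM_gt0 : 0 < invmx M i i * M i i.
  rewrite (_ : _ * _ = 1 - \sum_(k | k != i) invmx M i k * M k i).
    by rewrite subr_gt0 (le_lt_trans off_le0).
  by rewrite -ME addrK.
have inv_lt0 : invmx M i i < 0.
  rewrite lt_neqAle Minv andbT; apply: contraTneq MM_gt0 => ->.
  by rewrite mul0r ltxx.
by split=> //; rewrite -(nmulr_rgt0 _ inv_lt0).
Qed.

(** Exchanging weights and capacities makes the constraints that define [L]
    visibly linear in the weights. *)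
Lemma Lambda_mulC (R : realType) n (u v : 'cV[R]_n) :
  Lambda u *m v = Lambda v *m u.
Proof. by apply/colP => i; rewrite !mul_diag_mx !mxE mulrC. Qed.

Lemma invmx_Lambda_mul (R : realType) n (lam v : 'cV[R]_n) :
  ltv 0 lam -> invmx (Lambda lam) *m v = \col_i (v i 0 / lam i 0).
Proof.
move=> lam_gt0; have lam_neq0 i : lam i 0 != 0.
  by rewrite gt_eqF //; have := lam_gt0 i; rewrite mxE.
have Lunit : Lambda lam \in unitmx.
  rewrite unitmxE det_diag unitfE; apply/prodf_neq0 => i _.
  by rewrite mxE.
apply: (can_inj (mulKmx Lunit)); rewrite mulKVmx //.
by apply/colP => i; rewrite mul_diag_mx !mxE mulrC divfK.
Qed.


Lemma phatE (R : realType) n m (B : 'M[R]_(n, m)) (K : 'M[R]_(m, n))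
    (s lam : 'cV[R]_n) (r : 'cV[R]_m) k : ltv 0 lam ->
  phat B K s r lam k 0 =
    \sum_l (- invmx (B *m K) l k) * (s l 0 / lam l 0 + (K^T *m r) l 0).
Proof.
move=> lam_gt0; rewrite /phat invmx_Lambda_mul // 2!mxE -sumrN.
by apply: eq_bigr => l _; rewrite mulNr; congr (- (_ * _)); rewrite !mxE.
Qed.

Lemma mulmx_LambdaE (R : realType) n m (A : 'M[R]_(m, n)) (x lam : 'cV[R]_n) k :
  (A *m Lambda lam *m x) k 0 = \sum_l A k l * x l 0 * lam l 0.
Proof.
rewrite -mulmxA Lambda_mulC mulmxA /Lambda mul_mx_diag mxE.
by apply: eq_bigr => l _; rewrite !mxE.
Qed.

Lemma mulmx_tr_ge0 (R : realType) n m (K : 'M[R]_(m, n)) (r : 'cV[R]_m) :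
  (forall i j, 0 <= K i j) -> lev 0 r -> lev 0 (K^T *m r).
Proof.
move=> K_ge0 r_ge0 l; rewrite !mxE; apply: sumr_ge0 => j _.
by rewrite mxE mulr_ge0 //; have := r_ge0 j; rewrite mxE.
Qed.

(** All the terms of [phat_k] are nonnegative; only the one with the factor
    [s_k / lambda_k] is kept. It is positive, and it makes the cost coercive at
    the boundary of the positive orthant. *)
Lemma phat_ge (R : realType) n m (B : 'M[R]_(n, m)) (K : 'M[R]_(m, n))
    (s lam : 'cV[R]_n) (r : 'cV[R]_m) k :
  stable_metzler (B *m K) -> (forall i j, 0 <= K i j) ->
  ltv 0 s -> lev 0 r -> ltv 0 lam ->
  (- invmx (B *m K) k k) * (s k 0 / lam k 0) <= phat B K s r lam k 0.
Proof.
move=> stab K_ge0 s_gt0 r_ge0 lam_gt0; have [_ _ inv_le0] := stab.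
have sl l : 0 < s l 0 by have := s_gt0 l; rewrite mxE.
have laml l : 0 < lam l 0 by have := lam_gt0 l; rewrite mxE.
have rl l : 0 <= (K^T *m r) l 0.
  by have := mulmx_tr_ge0 K_ge0 r_ge0 l; rewrite mxE.
rewrite phatE // (bigD1 k) //= mulrDr -addrA lerDl addr_ge0 //.
  by rewrite mulr_ge0 // oppr_ge0.
apply: sumr_ge0 => l _; rewrite mulr_ge0 ?oppr_ge0 //.
by rewrite addr_ge0 // divr_ge0 // ltW.
Qed.

Lemma phat_gt0 (R : realType) n m (B : 'M[R]_(n, m)) (K : 'M[R]_(m, n))
    (s lam : 'cV[R]_n) (r : 'cV[R]_m) k :
  stable_metzler (B *m K) -> (forall i j, 0 <= K i j) ->
  ltv 0 s -> lev 0 r -> ltv 0 lam -> 0 < phat B K s r lam k 0.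
Proof.
move=> stab K_ge0 s_gt0 r_ge0 lam_gt0.
apply: lt_le_trans (phat_ge k stab K_ge0 s_gt0 r_ge0 lam_gt0).
have [_ inv_lt0] := stable_metzler_diag k stab.
rewrite mulr_gt0 ?oppr_gt0 // divr_gt0 //.
  by have := s_gt0 k; rewrite mxE.
by have := lam_gt0 k; rewrite mxE.
Qed.

(** * The geometric program *)

Lemma lambda_ofE (R : realType) n (y : 'cV[R]_(1 + n)) i :
  lambda_of y i 0 = y (rshift 1 i) 0.
Proof. by rewrite mxE. Qed.

Lemma gamma_ofE (R : realType) n (y : 'cV[R]_(1 + n)) :
  gamma_of y = y (lshift n 0) 0.
Proof. by rewrite /gamma_of mxE. Qed.

Lemma ltv_gamma_lambda (R : realType) n (y : 'cV[R]_(1 + n)) :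
  ltv 0 y <-> 0 < gamma_of y /\ ltv 0 (lambda_of y).
Proof.
split=> [y_gt0|[g_gt0 l_gt0] i].
  split=> [|i]; first by have := y_gt0 (lshift n 0); rewrite mxE gamma_ofE.
  by have := y_gt0 (rshift 1 i); rewrite lambda_ofE !mxE.
rewrite mxE; case: (split_ordP i) => j ->.
  by move: g_gt0; rewrite gamma_ofE (ord1 j).
by have := l_gt0 j; rewrite lambda_ofE mxE.
Qed.

Lemma weight_program_is_gp (R : realType) n m (B : 'M[R]_(n, m))
    (K : 'M[R]_(m, n)) (xbar : 'cV[R]_n) (ubar : 'cV[R]_m)
    (s : 'cV[R]_n) (r : 'cV[R]_m) :
  stable_metzler (B *m K) -> (forall i j, 0 <= K i j) ->
  ltv 0 xbar -> ltv 0 ubar -> ltv 0 s -> lev 0 r ->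
  is_geometric_program (weight_program B K xbar ubar s r).
Proof.
move=> stab K_ge0 xbar_gt0 ubar_gt0 s_gt0 r_ge0.
have [off_ge0 _ inv_le0] := stab.
have xl l : 0 < xbar l 0 by have := xbar_gt0 l; rewrite mxE.
have sl l : 0 < s l 0 by have := s_gt0 l; rewrite mxE.
have yl (y : 'cV[R]_(1 + n)) l : ltv 0 y -> 0 < y l 0.
  by move=> y_gt0; have := y_gt0 l; rewrite mxE.
split.
  exists [:: Monomial (fun k => if k == lshift n 0 then 1 else 0) ltr01].
  split=> // y y_gt0; rewrite /sum_monomials big_seq1 monomial_var powRr1.
    by rewrite /= gamma_ofE.
  by rewrite ltW // yl.
have linear_posynomial (P : pred 'I_n) (c : 'I_n -> R) :
    (forall l, P l -> 0 <= c l) -> posynomial_or_zero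
      (fun y : 'cV[R]_(1 + n) => \sum_(l | P l) c l * lambda_of y l 0).
  move=> c_ge0; apply: posynomial_sum => l Pl.
  apply: posynomialM; first exact/posynomial_const/c_ge0.
  have [f fE] := @posynomial_var R _ (rshift 1 l).
  by exists f => y y_gt0; rewrite lambda_ofE fE.
have lambda_posynomial l :
    posynomial_or_zero (fun y : 'cV[R]_(1 + n) => (lambda_of y l 0)^-1).
  have [f fE] := @posynomial_inv_var R _ (rshift 1 l).
  by exists f => y y_gt0; rewrite lambda_ofE fE.
move=> k; rewrite /=; case: (split_ordP k) => {k}[i ->|k ->].
  apply: (@gp_constraint_le _ _ _ (fun=> 1) (fun y => y (rshift 1 i) 0)) => //.
  - exact: posynomial_var.
  - by rewrite invr1; apply: posynomial_const.
  - by move=> y _; rewrite /= !col_mxEu lambda_ofE mxE.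
case: (split_ordP k) => {k}[e ->|k ->].
  apply: (@gp_constraint_le _ _ _ (fun=> ubar e 0)
           (fun y => \sum_l (K e l * xbar l 0) * lambda_of y l 0)).
  - by apply: linear_posynomial => l _; rewrite mulr_ge0 // ltW.
  - by apply: posynomial_const; have := ubar_gt0 e; rewrite mxE invr_ge0 => /ltW.
  - by move=> y _; have := ubar_gt0 e; rewrite mxE.
  - by move=> y _; rewrite /= !(col_mxEd, col_mxEu) mulmx_LambdaE.
case: (split_ordP k) => {k}[i ->|i ->].
  (* Row [i] of [M Lambda xbar]: only its diagonal term is negative, and it is
     the monomial moved to the right-hand side. *)
  have [diag_lt0 _] := stable_metzler_diag i stab.
  pose a := - ((B *m K) i i * xbar i 0).
  have a_gt0 : 0 < a by rewrite oppr_gt0 nmulr_rlt0.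
  apply: (@gp_constraint_le _ _ _ (fun y => a * lambda_of y i 0)
     (fun y => \sum_(l | l != i) ((B *m K) i l * xbar l 0) * lambda_of y l 0)).
  - apply: linear_posynomial => l li.
    by rewrite mulr_ge0 ?off_ge0 // 1?eq_sym // ltW.
  - have [||f fE] := @posynomialM R (1 + n) (fun=> a^-1)
                       (fun y => (lambda_of y i 0)^-1).
    + by apply: posynomial_const; rewrite invr_ge0 ltW.
    + exact: lambda_posynomial.
    + by exists f => y y_gt0; rewrite invfM fE.
  - by move=> y y_gt0; rewrite lambda_ofE mulr_gt0 ?yl.
  - move=> y _; rewrite /= !(col_mxEd, col_mxEu) mulmx_LambdaE [X in _ <= X]mxE.
    by rewrite (bigD1 i) //= -lerBrDl sub0r -mulNr.
apply: (@gp_constraint_le _ _ _ (fun y => gamma_of y * s i 0)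
  (fun y => \sum_l (- invmx (B *m K) l i) *
              (s l 0 / lambda_of y l 0 + (K^T *m r) l 0))).
- apply: posynomial_sum => l _; apply: posynomialM.
    by apply: posynomial_const; rewrite oppr_ge0.
  apply: posynomialD; last first.
    by apply: posynomial_const; have := mulmx_tr_ge0 K_ge0 r_ge0 l; rewrite mxE.
  apply: posynomialM; last exact: lambda_posynomial.
  by apply: posynomial_const; rewrite ltW.
- have [||f fE] := @posynomialM R (1 + n) (fun=> (s i 0)^-1)
                     (fun y => (y (lshift n 0) 0)^-1).
  + by apply: posynomial_const; rewrite invr_ge0 ltW.
  + exact: posynomial_inv_var.
  + by exists f => y y_gt0; rewrite gamma_ofE mulrC invfM fE.
- by move=> y y_gt0; rewrite gamma_ofE mulr_gt0 ?yl.
- move=> y /ltv_gamma_lambda[_ l_gt0].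
  by rewrite /= !(col_mxEd, col_mxEu) phatE // [X in _ <= X]mxE.
Qed.

(** * Existence of an optimal weight *)

Lemma small_multiple (R : realType) (I : finType) (a b : I -> R) :
  (forall i, 0 <= a i) -> (forall i, 0 < b i) ->
  exists2 e : R, 0 < e & forall e', 0 < e' <= e -> forall i, e' * a i <= b i.
Proof.
move=> a_ge0 b_gt0; pose c := 1 + \sum_i a i / b i.
have ab_ge0 i : 0 <= a i / b i by rewrite divr_ge0 // ltW.
have c_gt0 : 0 < c by rewrite ltr_wpDr // sumr_ge0.
exists c^-1 => [|e /andP[e_gt0 ec] i]; first by rewrite invr_gt0.
have a_le : a i <= c * b i.
  rewrite -ler_pdivrMr // /c (bigD1 i) //= addrCA lerDl addr_ge0 //.
  exact: sumr_ge0.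
have -> : b i = c^-1 * (c * b i) by rewrite mulKf // gt_eqF.
by rewrite ler_pM // ltW.
Qed.

(** The flow [z = - M^-1 1] is positive and satisfies [M z = -1 < 0], so a small
    multiple of it, written as [Lambda xbar], meets all the constraints. *)
Lemma Lset_nonempty (R : realType) n m (B : 'M[R]_(n, m)) (K : 'M[R]_(m, n))
    (xbar : 'cV[R]_n) (ubar : 'cV[R]_m) :
  stable_metzler (B *m K) -> (forall i j, 0 <= K i j) ->
  ltv 0 xbar -> ltv 0 ubar -> Lset B K xbar ubar !=set0.
Proof.
move=> stab K_ge0 xbar_gt0 ubar_gt0; have [_ Munit inv_le0] := stab.
have xl l : 0 < xbar l 0 by have := xbar_gt0 l; rewrite mxE.
have ue e : 0 < ubar e 0 by have := ubar_gt0 e; rewrite mxE.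
pose z : 'cV[R]_n := - (invmx (B *m K) *m const_mx 1).
have zE i : z i 0 = \sum_j - invmx (B *m K) i j.
  by rewrite !mxE -sumrN; apply: eq_bigr => j _; rewrite mxE mulr1.
have z_gt0 i : 0 < z i 0.
  have [_ inv_lt0] := stable_metzler_diag i stab.
  rewrite zE (bigD1 i) //= ltr_wpDr ?oppr_gt0 // sumr_ge0 // => j _.
  by rewrite oppr_ge0.
have [i|d1 d1_gt0 d1P] := small_multiple (a := z^~ 0) _ xl; first exact/ltW.
have [e|d2 d2_gt0 d2P] := small_multiple (a := (K *m z)^~ 0) _ ue.
  by rewrite mxE sumr_ge0 // => j _; rewrite mulr_ge0 // ltW.
pose d := Num.min d1 d2.
have d_gt0 : 0 < d by rewrite lt_min d1_gt0 d2_gt0.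
pose lam : 'cV[R]_n := \col_i (d * z i 0 / xbar i 0).
have lamE i : lam i 0 = d * z i 0 / xbar i 0 by rewrite mxE.
have lamx : Lambda lam *m xbar = d *: z.
  apply/colP => i; rewrite mul_diag_mx mxE [lam^T _ _]mxE lamE divfK ?gt_eqF //.
  by rewrite [RHS]mxE.
exists lam; split=> [i|i|e|i].
- by rewrite lamE [_ i 0]mxE divr_gt0 // mulr_gt0.
- rewrite lamE [const_mx _ _ _]mxE ler_pdivrMr // mul1r d1P // d_gt0 /=.
  by rewrite ge_min lexx.
- rewrite -mulmxA lamx -scalemxAr mxE d2P // d_gt0 /=.
  by rewrite ge_min lexx orbT.
- rewrite -mulmxA lamx -scalemxAr mulmxN mulKVmx // !mxE mulrN1 oppr_le0.
  exact: ltW.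
Qed.

Lemma closed_polyhedron (R : realType) n m (A : 'M[R]_(m, n)) (b : 'cV[R]_m) :
  closed [set v : 'rV[R]_n | lev (A *m v^T) b].
Proof.
have -> : [set v : 'rV[R]_n | lev (A *m v^T) b] =
    \bigcap_(k in [set: 'I_m])
      (fun v : 'rV[R]_n => \sum_l A k l * v 0 l) @^-1` [set x | x <= b k 0].
  apply/seteqP; split=> v /= Av k => [_|].
    have := Av k; rewrite mxE /=.
    by under eq_bigr do rewrite mxE.
  have /= := Av k I; rewrite mxE.
  by under [X in _ -> X <= _]eq_bigr do rewrite mxE.
apply: closed_bigI => k _; apply: preimage_closed; last exact: closed_le.
move=> v _; apply: (continuous_big add_continuous) => l _ {}v.
by apply: continuousM; [exact: cst_continuous|exact: coord_continuous].
Qed.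

Lemma max_entry_le (R : realType) n (n_gt0 : (0 < n)%N) (f : 'I_n -> R) a :
  max_entry n_gt0 f <= a <-> forall i, f i <= a.
Proof.
split=> [fa i|fa]; first exact: le_trans (le_bigmax _ _ _) fa.
by apply: bigmax_le => [|i _]; exact: fa.
Qed.

(** Continuity of an iterated maximum asks for a constant neutral element. *)
Lemma max_entry_bigmax0 (R : realType) n (n_gt0 : (0 < n)%N) (f : 'I_n -> R) :
  (forall i, 0 <= f i) -> max_entry n_gt0 f = \big[Num.max/0]_i f i.
Proof.
move=> f_ge0; apply/le_anti/andP; split.
  by apply/max_entry_le => i; exact: le_bigmax.
apply: bigmax_le => [|i _]; last exact: le_bigmax.
exact: le_trans (f_ge0 (Ordinal n_gt0)) (le_bigmax _ _ _).
Qed.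

(** Weights that cost at most [c] satisfy [lambda_i >= - (M^-1)_ii / c], so the
    infimum over [L] is that over a closed part [A] of a compact box. *)
Lemma max_cost_attained (R : realType) n m (n_gt0 : (0 < n)%N)
    (B : 'M[R]_(n, m)) (K : 'M[R]_(m, n)) (xbar : 'cV[R]_n) (ubar : 'cV[R]_m)
    (s : 'cV[R]_n) (r : 'cV[R]_m) :
  stable_metzler (B *m K) -> (forall i j, 0 <= K i j) ->
  ltv 0 xbar -> ltv 0 ubar -> ltv 0 s -> lev 0 r ->
  let L := Lset B K xbar ubar in
  let cost lam := max_entry n_gt0 (fun i => phat B K s r lam i 0 / s i 0) in
  exists2 lam, L lam & forall lam', L lam' -> cost lam <= cost lam'.
Proof.
move=> stab K_ge0 xbar_gt0 ubar_gt0 s_gt0 r_ge0 L cost.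
have sl l : 0 < s l 0 by have := s_gt0 l; rewrite mxE.
have phat_pos lam : ltv 0 lam -> forall i, 0 < phat B K s r lam i 0 / s i 0.
  by move=> lam_gt0 i; rewrite divr_gt0 // phat_gt0.
have [lam0 Llam0] := Lset_nonempty stab K_ge0 xbar_gt0 ubar_gt0.
have cost_gt0 lam : L lam -> 0 < cost lam.
  case=> lam_gt0 _ _ _; pose i := Ordinal n_gt0.
  apply: lt_le_trans (phat_pos _ lam_gt0 i) _; exact: le_bigmax.
pose c := cost lam0; have c_gt0 : 0 < c by exact: cost_gt0.
pose d i := - invmx (B *m K) i i / c.
have d_gt0 i : 0 < d i.
  by have [_ inv_lt0] := stable_metzler_diag i stab; rewrite divr_gt0 ?oppr_gt0.
have d_le lam : L lam -> cost lam <= c -> forall i, d i <= lam i 0.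
  move=> [lam_gt0 _ _ _] /max_entry_le cost_le i.
  have lami : 0 < lam i 0 by have := lam_gt0 i; rewrite mxE.
  have := cost_le i; rewrite ler_pdivrMr // => phat_le.
  have := le_trans (phat_ge i stab K_ge0 s_gt0 r_ge0 lam_gt0) phat_le.
  rewrite mulrA ler_pdivrMr // mulrAC ler_pM2r //.
  by rewrite /d ler_pdivrMr // mulrC.
pose A := [set v : 'rV[R]_n | forall i, `[d i, 1]%classic (v 0 i)] `&`
  ([set v | lev (K *m Lambda xbar *m v^T) ubar] `&`
   [set v | lev (B *m K *m Lambda xbar *m v^T) 0]).
have AE lam : A lam^T <-> L lam /\ forall i, d i <= lam i 0.
  rewrite /A /= trmxK -!mulmxA -[Lambda xbar *m lam]Lambda_mulC !mulmxA.
  split=> [[box [Ku BKu]]|[[lam_gt0 lam_le1 Ku BKu] lam_ge]].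
    have {}box i : d i <= lam i 0 <= 1.
      by have /= := box i; rewrite in_itv mxE.
    split=> [|i]; last by have /andP[] := box i.
    split=> // i; have /andP[di i1] := box i; last by rewrite mxE.
    by rewrite mxE (lt_le_trans (d_gt0 i)).
  split=> // i; rewrite /= in_itv /= mxE lam_ge.
  by have := lam_le1 i; rewrite mxE.
have A_compact : compact A.
  apply: compact_closedI; last by apply: closedI; exact: closed_polyhedron.
  apply: (@rV_compact R n (fun i => `[d i, 1]%classic)) => i.
  exact: segment_compact.
have A_neq0 : A !=set0.
  by exists lam0^T; apply/AE; split=> //; exact: d_le.
have cost_cont : {within A, continuous (fun v => cost v^T)}.
  pose g (v : 'rV[R]_n) := \big[Num.max/0]_(i < n)
    ((\sum_l (- invmx (B *m K) l i) * (s l 0 / v 0 l + (K^T *m r) l 0)) / s i 0).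
  apply: (@subspace_eq_continuous _ _ _ g) => [v|].
    rewrite inE -[v]trmxK => /AE[[lam_gt0 _ _ _] _]; rewrite trmxK /cost.
    apply/esym; rewrite /from_subspace /= max_entry_bigmax0 => [|i]; last first.
      by rewrite ltW // phat_pos.
    apply: eq_bigr => i _; rewrite phatE //; congr (_ / _).
    by apply: eq_bigr => l _; rewrite [v^T _ _]mxE.
  apply: continuous_in_subspaceT => v.
  rewrite inE -{1}[v]trmxK => /AE[[lam_gt0 _ _ _] _].
  have term_cont l i : {for v, continuous (fun w : 'rV[R]_n =>
      (- invmx (B *m K) l i) * (s l 0 / w 0 l + (K^T *m r) l 0))}.
    apply: continuousM; first exact: cst_continuous.
    apply: continuousD; last exact: cst_continuous.
    apply: continuousM; first exact: cst_continuous.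
    apply: continuousV; last exact: coord_continuous.
    by have := lam_gt0 l; rewrite !mxE => /lt0r_neq0.
  have phat_cont i : {for v, continuous (fun w : 'rV[R]_n =>
      (\sum_l (- invmx (B *m K) l i) * (s l 0 / w 0 l + (K^T *m r) l 0))
        / s i 0)}.
    apply: continuousM; last exact: cst_continuous.
    apply: (@cvg_big _ _ _ _ _ add_continuous _ (nbhs v)) => l _.
    exact: term_cont.
  apply: (@cvg_big _ _ _ _ _ max_continuous _ (nbhs v)) => i _.
  exact: phat_cont.
have [v] := EVT_min_rV A_neq0 A_compact cost_cont.
rewrite inE -[v]trmxK => /AE[Lv _] vmin; exists v^T => // lam Llam.
(* Outside of the sublevel set, compare with the reference point [lam0]. *)
have [lam_le|/ltW lam_ge] := leP (cost lam) c.
  have /vmin : lam^T \in A by rewrite inE; apply/AE; split=> //; exact: d_le.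
  by rewrite !trmxK.
apply: le_trans lam_ge.
have /vmin : lam0^T \in A by rewrite inE; apply/AE; split=> //; exact: d_le.
by rewrite !trmxK.
Qed.

(** * The closed-loop matrix of the network *)

Lemma Kmat_ge0 (R : realType) n (E : 'I_n -> {set 'I_n.+1})
    (r : 'cV[R]_(edges E)) (p : 'cV[R]_n) i j : 0 <= Kmat r p i j.
Proof. by rewrite !mxE ler0n. Qed.

(** The only nonzero entry of column [i] of [K] selects the edge from [i] to the
    successor [t] of minimal reduced cost.  The Bellman equation makes this
    cost, [r + p t - p i], negative, so [p] decreases along the edge. *)
Lemma closed_loop_row (R : realType) n (E : 'I_n -> {set 'I_n.+1})
    (s : 'cV[R]_n) (r : 'cV[R]_(edges E)) (p : 'cV[R]_n) (i : 'I_n) :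
  no_loop E -> ltv 0 s -> lev 0 r -> bellman_equation s r p ->
  exists2 t : 'I_n.+1,
    forall w : 'rV[R]_n,
      (w *m (Bmat R E *m Kmat r p)) 0 i = at_vertex (w 0) t - w 0 i
  & at_vertex (p ^~ 0) t < p i 0.
Proof.
move=> noloop s_gt0 r_ge0 bell.
have [j jfirst jdecr] := bellman_step i noloop s_gt0 r_ge0 bell.
exists (enum_val j) => // w; rewrite -Bblock_sum // mxE.
rewrite mul_mxrow_mxcol; apply: eq_bigr => k _; rewrite mulrC; congr (_ * _).
rewrite summxE (bigD1 i) //= big1 ?addr0; last first.
  move=> l li; rewrite mxE big1 // => e _.
  by rewrite [X in _ * X]mxE eq_sym (negPf li) andbF mulr0.
rewrite mxE (bigD1 j) //= big1 ?addr0; last first.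
  by move=> e ej; rewrite [X in _ * X]mxE jfirst (negPf ej) mulr0.
by rewrite [X in _ * X]mxE jfirst !eqxx mulr1.
Qed.

(** Minus a row of [M^-1] is superharmonic, [v (succ i) <= v i], so a negative
    value would propagate along a path on which [p] strictly decreases, hence
    to the goal, where [v] vanishes. *)
Lemma closed_loop_stable_metzler (R : realType) n (E : 'I_n -> {set 'I_n.+1})
    (s : 'cV[R]_n) (r : 'cV[R]_(edges E)) (p : 'cV[R]_n) :
  no_loop E -> ltv 0 s -> lev 0 r -> bellman_equation s r p ->
  stable_metzler (Bmat R E *m Kmat r p).
Proof.
move=> noloop s_gt0 r_ge0 bell.
have loop i := closed_loop_row i noloop s_gt0 r_ge0 bell.
have Munit := BK_unitmx noloop s_gt0 r_ge0 bell.
split=> // [k i ki|k i].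
  have [t tE _] := loop i.
  have -> : (Bmat R E *m Kmat r p) k i =
      (('e_k : 'rV[R]_n) *m (Bmat R E *m Kmat r p)) 0 i.
    by rewrite -rowE [RHS]mxE.
  rewrite tE [X in _ - X]mxE [i == k]eq_sym (negPf ki) andbF subr0.
  by rewrite /at_vertex; case: unlift => // l; rewrite mxE ler0n.
pose v := - row k (invmx (Bmat R E *m Kmat r p)).
have v_superharmonic l t :
    (forall w : 'rV[R]_n,
      (w *m (Bmat R E *m Kmat r p)) 0 l = at_vertex (w 0) t - w 0 l) ->
    at_vertex (v 0) t <= v 0 l.
  move=> /(_ v); rewrite mulNmx -row_mul mulVmx // => vE.
  by rewrite -subr_le0 -vE !mxE oppr_le0 ler0n.
suff : 0 <= v 0 i by rewrite !mxE oppr_ge0.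
rewrite leNgt; apply/negP => vi.
case: (@arg_minP _ R _ i (fun l => v 0 l < 0) (p ^~ 0) vi) => l vl lmin.
have [t /v_superharmonic tv] := loop l.
move: tv; rewrite /at_vertex; case: unlift => [h tv|tv _].
  by rewrite ltNge lmin // (le_lt_trans tv).
by rewrite ltNge tv in vl.
Qed.

Theorem proposition3 (R : realType) (n : nat) (n_gt0 : (0 < n)%N)
    (E : 'I_n -> {set 'I_n.+1}) (E_no_loop : no_loop E)
    (xbar : 'cV[R]_n) (xbar_gt0 : ltv 0 xbar)
    (ubar : 'cV[R]_(edges E)) (ubar_gt0 : ltv 0 ubar)
    (s : 'cV[R]_n) (s_gt0 : ltv 0 s)
    (r : 'cV[R]_(edges E)) (r_ge0 : lev 0 r)
    (p : 'cV[R]_n) (p_gt0 : ltv 0 p)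
    (p_bellman : bellman_equation s r p) :
  let B := Bmat R E in
  let K := Kmat r p in
  let L := Lset B K xbar ubar in
  let F := original_feasible B K xbar ubar s r in
  let P := weight_program B K xbar ubar s r in
  [/\ feasible P = F,
      is_geometric_program P
    & exists gstar : R,
        is_minimum
          [set max_entry n_gt0 (fun i => phat B K s r lam i 0 / s i 0)
             | lam in L] gstar
        /\ optimal_value (objective P) F = gstar%:E].
Proof.
move=> B K L F P.
have stab : stable_metzler (B *m K).
  exact: closed_loop_stable_metzler s_gt0 _ _.
have K_ge0 i j : 0 <= K i j by exact: Kmat_ge0.
have sl l : 0 < s l 0 by have := s_gt0 l; rewrite mxE.
split.
- apply/seteqP; split=> y.
    case=> /ltv_gamma_lambda[g_gt0 l_gt0] cons.
    have c1 i := cons (lshift _ i); have {}cons i := cons (rshift _ i).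
    have c2 i := cons (lshift _ i); have {}cons i := cons (rshift _ i).
    have c3 i := cons (lshift _ i); have c4 i := cons (rshift _ i).
    split; first split=> // i.
    + by have := c1 i; rewrite /= !col_mxEu.
    + by have := c2 i; rewrite /= !(col_mxEd, col_mxEu).
    + by have := c3 i; rewrite /= !(col_mxEd, col_mxEu).
    + by move=> i; have := c4 i; rewrite /= !(col_mxEd, col_mxEu).
  case=> -[l_gt0 l_le1 Ku BKu] phat_le; split.
    apply/ltv_gamma_lambda; split=> //.
    have := phat_le (Ordinal n_gt0); rewrite [X in _ <= X]mxE.
    move=> /(lt_le_trans (phat_gt0 _ stab K_ge0 s_gt0 r_ge0 l_gt0)).
    by rewrite pmulr_lgt0.
  move=> k; rewrite /=.
  by do 3?[case: (split_ordP k) => {k}[i ->|k ->];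
             rewrite ?(col_mxEd, col_mxEu) //].
- exact: weight_program_is_gp.
have [lam Llam lam_min] := max_cost_attained n_gt0 stab K_ge0 xbar_gt0 ubar_gt0
                             s_gt0 r_ge0.
exists (max_entry n_gt0 (fun i => phat B K s r lam i 0 / s i 0)); split.
  by split; [exists lam | move=> _ [lam' Llam' <-]; exact: lam_min].
apply/le_anti/andP; split.
  apply: ereal_inf_lbound.
  set g := max_entry _ _; exists (col_mx (const_mx g) lam).
    rewrite /F /original_feasible /= /lambda_of /gamma_of col_mxKd col_mxKu.
    split=> // i; rewrite [X in _ <= X]mxE [const_mx _ _ _]mxE -ler_pdivrMr //.
    exact: (max_entry_le n_gt0 _ g).1 (lexx g) i.
  by rewrite /= /gamma_of col_mxKu mxE.
apply: le_ereal_inf_tmp => _ [y [Ly y_le] <-]; rewrite lee_fin.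
apply: le_trans (lam_min _ Ly) _; apply/max_entry_le => i.
by rewrite ler_pdivrMr //; have := y_le i; rewrite [X in _ <= X]mxE.
Qed.
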